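(* Let $G\le\mathrm{Sym}(\Gamma)$ and $H\le\mathrm{Sym}(\Delta)$ be transitive permutation groups on finite sets $\Gamma$ and $\Delta$, and let $G\times H$ act componentwise on $\Gamma\times\Delta$. If $G$ and $H$ are pre-primitive and $|\Gamma|$ and $|\Delta|$ are coprime, then $G\times H$ is pre-primitive.
   Context: The componentwise action of $G\times H$ on $\Gamma\times\Delta$ is $(\gamma,\delta)(g,h)=(\gamma g,\delta h)$. A partition of $\Omega$ is $G$-invariant if every $g\in G$ maps each part onto a part. The orbit partition of a subgroup is the partition of $\Omega$ into its orbits. A transitive permutation group $G$ on a finite set $\Omega$ is pre-primitive if every $G$-invariant partition of $\Omega$ is the orbit partition of some subgroup of $G$. *)

(* Defs.v *)
From HB Require Import structures.
From mathcomp Require Import all_boot all_fingroup.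

Set Implicit Arguments.
Unset Strict Implicit.
Unset Printing Implicit Defensive.

Import GroupScope.

(* A subgroup G of Sym(T) is a group G : {group {perm T}} with its natural
   action 'P.  The notions below are stated for an arbitrary action so that
   they also apply to the (faithful, if both sets are nonempty) componentwise
   action of a direct product of permutation groups. *)
Section PrePrimitive.

Variables (aT : finGroupType) (T : finType) (to : {action aT &-> T}).

Definition invariant_partition (G : {group aT}) (P : {set {set T}}) : Prop :=
  partition P [set: T] /\
  forall g B, g \in G -> B \in P -> to^*%act B g \in P.

Definition orbit_partition (K : {group aT}) : {set {set T}} :=
  [set orbit to K x | x : T].

Definition preprimitive (G : {group aT}) : Prop :=
  [transitive G, on [set: T] | to] /\
  forall P : {set {set T}}, invariant_partition G P ->
    exists2 K : {group aT}, K \subset G & P = orbit_partition K.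

End PrePrimitive.

Section ProductAction.

Variables (aT bT : finGroupType) (T U : finType).
Variables (to1 : {action aT &-> T}) (to2 : {action bT &-> U}).

Definition prod_act (x : T * U) (gh : aT * bT) : T * U :=
  (to1 x.1 gh.1, to2 x.2 gh.2).

Lemma prod_act1 : prod_act^~ 1 =1 id.
Proof. by case=> x y; rewrite /prod_act /= !act1. Qed.

Lemma prod_actM x : act_morph prod_act x.
Proof. by case=> g h [g' h']; rewrite /prod_act /= !actM. Qed.

Canonical prod_action := TotalAction prod_act1 prod_actM.

End ProductAction.

(* Main.v *)
Require Import Defs.
From HB Require Import structures.
From mathcomp Require Import all_boot all_fingroup.
From mathcomp Require Import cyclic.

Set Implicit Arguments.
Unset Strict Implicit.
Unset Printing Implicit Defensive.

Import GroupScope.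

(** Let [P] be an invariant partition of the product set, [z = (x, y)] a point,
    and [L] the stabiliser in [G x H] of the block of [z].  Then [L] contains
    the point stabiliser [G_x x H_y], and the block of [z] is the [L]-orbit of
    [z].

    Coprimality makes [L] a direct product.  By Goursat's lemma a subgroup of
    [G x H] is described by an isomorphism between sections [L1/N1] of [G] and
    [L2/N2] of [H], where [L1], [L2] are the projections of [L] and [N1], [N2]
    its intersections with the factors.  Here [N1] contains [G_x] and [N2]
    contains [H_y], so the two isomorphic quotients have orders dividing the
    coprime degrees [|G : G_x|] and [|H : H_y|]; hence they are trivial.  This
    is [coprime_Goursat], proved on elements: if [(g, h)] is in [L], then [h]
    raised to either degree is in [N2], so [h] itself is.

    Consequently every block is a rectangle ([mem_pblock_prod]), cut out by its
    traces on the horizontal and vertical fibres.  Since [G x 1] and [1 x H] act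
    on the fibres and [G], [H] are transitive, these traces are the blocks of a
    [G]-invariant partition and of an [H]-invariant partition which do not
    depend on the chosen fibres.  Pre-primitivity of the factors presents them
    as the orbit partitions of some [K1] and [K2], and then [P] is the orbit
    partition of [K1 x K2]. *)

(** * Subgroups of a direct product with coprime index conditions *)

(** The order of [g] modulo [N] divides [|M : N|], which divides [|G : A|]. *)
Lemma expg_index_in_normal (gT : finGroupType) (A N M G : {group gT}) (g : gT) :
  A \subset N -> N <| M -> M \subset G -> g \in M -> g ^+ #|G : A| \in N.
Proof.
move=> sAN nNM sMG gM; have [sNM nN] := andP nNM.
have gN : g \in 'N(N) := subsetP nN g gM.
apply: coset_idr; first exact: groupX.
rewrite morphX //; apply/eqP; rewrite -order_dvdn.
have o_dvd : #[coset N g] %| #|M : N|.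
  by rewrite -card_quotient //; apply/order_dvdG/mem_quotient.
apply: dvdn_trans o_dvd _.
rewrite -(Lagrange_index (subset_trans sNM sMG) sAN) -(Lagrange_index sMG sNM).
by rewrite dvdn_mulr // dvdn_mull.
Qed.

(** The order of [g] modulo [N] divides both exponents, so it is 1. *)
Lemma mem_of_coprime_expg (gT : finGroupType) (N : {group gT}) (g : gT) m n :
  coprime m n -> g \in 'N(N) -> g ^+ m \in N -> g ^+ n \in N -> g \in N.
Proof.
move=> co_mn gN gm gn; apply: coset_idr => //; apply/eqP; rewrite -order_eq1.
rewrite -dvdn1 -(eqnP co_mn) dvdn_gcd !order_dvdn.
by rewrite -!morphX //= !coset_id ?eqxx.
Qed.

Section CoprimeGoursat.

Variables (aT bT : finGroupType) (A G : {group aT}) (B H : {group bT}).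
Variable L : {group aT * bT}.
Hypotheses (sABL : setX A B \subset L) (sLGH : L \subset setX G H).

Let N1 := (@pairg1 aT bT @*^-1 L)%G.
Let N2 := (@pair1g aT bT @*^-1 L)%G.

Let mem_N1 g : (g \in N1) = ((g, 1) \in L).
Proof. by rewrite !inE. Qed.

Let mem_N2 h : (h \in N2) = ((1, h) \in L).
Proof. by rewrite !inE. Qed.

Let N1_normal : N1 <| @fst aT bT @* L.
Proof.
apply/andP; split.
  apply/subsetP=> g; rewrite mem_N1 => gL.
  by apply/morphimP; exists (g, 1); rewrite ?inE.
apply/subsetP=> _ /morphimP[[g h] _ ghL ->] /=; rewrite inE.
apply/subsetP=> _ /imsetP[n nN ->]; move: nN; rewrite !mem_N1 => nL.
suff -> : (n ^ g, 1) = (n, 1 : bT) ^ (g, h) by exact: groupJ.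
by congr (_, _); rewrite /= mul1g mulVg.
Qed.

Let N2_normal : N2 <| @snd aT bT @* L.
Proof.
apply/andP; split.
  apply/subsetP=> h; rewrite mem_N2 => hL.
  by apply/morphimP; exists (1, h); rewrite ?inE.
apply/subsetP=> _ /morphimP[[g h] _ ghL ->] /=; rewrite inE.
apply/subsetP=> _ /imsetP[n nN ->]; move: nN; rewrite !mem_N2 => nL.
suff -> : (1, n ^ h) = (1 : aT, n) ^ (g, h) by exact: groupJ.
by congr (_, _); rewrite /= mul1g mulVg.
Qed.

(** Goursat's lemma in the degenerate case: the common quotient of the two
    projections of [L] has order dividing two coprime indices, so [L] is the
    product of its intersections with the two factors. *)
Lemma coprime_Goursat g h : coprime #|G : A| #|H : B| ->
  (g, h) \in L -> (g, 1) \in L /\ (1, h) \in L.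
Proof.
move=> co_idx ghL.
have sAN : A \subset N1.
  by apply/subsetP=> a aA; rewrite mem_N1 (subsetP sABL) // !inE aA group1.
have sBN : B \subset N2.
  by apply/subsetP=> b bB; rewrite mem_N2 (subsetP sABL) // !inE bB group1.
have sLG : @fst aT bT @* L \subset G.
  apply/subsetP=> _ /morphimP[x _ xL ->].
  by have := subsetP sLGH x xL; rewrite inE => /andP[].
have sLH : @snd aT bT @* L \subset H.
  apply/subsetP=> _ /morphimP[x _ xL ->].
  by have := subsetP sLGH x xL; rewrite inE => /andP[].
have gL1 : g \in @fst aT bT @* L by apply/morphimP; exists (g, h); rewrite ?inE.
have hL2 : h \in @snd aT bT @* L by apply/morphimP; exists (g, h); rewrite ?inE.
have g_idx : g ^+ #|G : A| \in N1.
  exact: (expg_index_in_normal sAN N1_normal sLG gL1).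
have h_idx : h ^+ #|H : B| \in N2.
  exact: (expg_index_in_normal sBN N2_normal sLH hL2).
have expE n : (g, h) ^+ n = (g ^+ n, h ^+ n).
  by elim: n => // n IHn; rewrite !expgS IHn.
(* [g] and [h] have the same order modulo [N1] and [N2], so the exponent that
   kills [g] also kills [h]. *)
have h_idx' : h ^+ #|G : A| \in N2.
  rewrite mem_N2.
  set m := #|G : A| in g_idx *.
  have -> : (1, h ^+ m) = (g ^+ m, 1 : bT)^-1 * (g, h) ^+ m.
    by rewrite expE; congr (_, _); rewrite /= ?mulVg // invg1 mul1g.
  by rewrite groupM ?groupV ?groupX // -mem_N1.
have hN : h \in N2.
  apply: mem_of_coprime_expg co_idx _ h_idx' h_idx.
  exact: subsetP (normal_norm N2_normal) h hL2.
rewrite mem_N2 in hN; split=> //.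
have -> : (g, 1) = (g, h) * (1, h)^-1.
  by congr (_, _); rewrite /= ?mulgV // invg1 mulg1.
by rewrite groupM ?groupV.
Qed.

End CoprimeGoursat.

(** * Blocks of invariant partitions *)

Section InvariantPartition.

Variables (aT : finGroupType) (T : finType) (to : {action aT &-> T}).
Variables (G : {group aT}) (P : {set {set T}}).

Lemma mem_pblock_act : invariant_partition to G P -> forall g x y, g \in G ->
  (to y g \in pblock P (to x g)) = (y \in pblock P x).
Proof.
move=> [/and3P[/eqP covP tiP _] invP] g x y gG.
have xP z : z \in cover P by rewrite covP inE.
have blk : to^*%act (pblock P x) g \in P by apply: invP; rewrite ?pblock_mem.
have xg : to x g \in to^*%act (pblock P x) g by rewrite mem_setact ?mem_pblock.
by rewrite (def_pblock tiP blk xg) /= setactE (mem_imset _ _ (act_inj to g)).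
Qed.

(** Blocks are permuted by [G] and pairwise disjoint, so moving one point of a
    block within that block already forces the whole block to be fixed. *)
Lemma astabs_pblock x g : invariant_partition to G P -> g \in G ->
  (g \in 'N(pblock P x | to)) = (to x g \in pblock P x).
Proof.
move=> invP gG; have [/and3P[/eqP covP tiP _] _] := invP.
have x_blk : x \in pblock P x by rewrite mem_pblock covP inE.
apply/astabsP/idP.
  by move=> ->.
move=> xg_blk z.
by rewrite -{1}(same_pblock tiP xg_blk) (mem_pblock_act invP).
Qed.

Lemma orbit_partition_eq (K : {group aT}) : partition P [set: T] ->
  P = Defs.orbit_partition to K <-> forall x, pblock P x = orbit to K x.
Proof.
move=> /and3P[/eqP covP tiP nz]; have xP z : z \in cover P by rewrite covP inE.
split=> [defP x | blkP].
  apply: def_pblock; rewrite ?orbit_refl //.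
  by rewrite defP; apply/imsetP; exists x.
apply/setP=> B; apply/idP/imsetP => [BP | [x _ ->]].
  have [B0 | [x xB]] := set_0Vmem B; first by rewrite -B0 BP in nz.
  by exists x; rewrite // -blkP (def_pblock tiP BP xB).
by rewrite -blkP pblock_mem.
Qed.

End InvariantPartition.

(** Pre-primitivity in terms of invariant equivalence relations: the invariant
    partitions of the factors arise below as fibre relations, and only
    membership in the corresponding orbits matters for the product. *)
Lemma preprimitive_rel (aT : finGroupType) (T : finType)
    (to : {action aT &-> T}) (G : {group aT}) (e : rel T) :
  preprimitive to G -> equivalence_rel e ->
  (forall g x y, g \in G -> e x y -> e (to x g) (to y g)) ->
  exists2 K : {group aT}, K \subset G & forall x y, e x y = (y \in orbit to K x).
Proof.
move=> [_ ppG] eqe inv_e.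
have eqT : {in [set: T] & &, equivalence_rel e} by move=> x y z _ _ _; exact: eqe.
set P := equivalence_partition e [set: T].
have partP : partition P [set: T] := equivalence_partitionP eqT.
have mem_blk x y : (y \in pblock P x) = e x y.
  by rewrite (pblock_equivalence_partition eqT) ?inE.
have [|K sKG /(orbit_partition_eq _ _ partP) defP] := ppG P; last first.
  by exists K => // x y; rewrite -defP mem_blk.
split=> // g _ gG /imsetP[x _ ->]; apply/imsetP; exists (to x g) => //.
(* The relation is only assumed to be preserved by [G]; acting by the inverse
   shows that it is reflected as well, so that blocks map onto blocks. *)
apply/setP=> z; rewrite -(actKV to g z) /= setactE.
rewrite (mem_imset _ _ (act_inj to g)).
rewrite !inE; apply/idP/idP=> [|exz]; first exact: inv_e.
by rewrite -[x](actK to g) -[to z _](actK to g) inv_e ?groupV.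
Qed.

(** * Coprime products of transitive actions *)

Section CoprimeProduct.

Variables (aT bT : finGroupType) (T U : finType).
Variables (to1 : {action aT &-> T}) (to2 : {action bT &-> U}).
Variables (G : {group aT}) (H : {group bT}).
Hypotheses (transG : [transitive G, on [set: T] | to1]).
Hypotheses (transH : [transitive H, on [set: U] | to2]).

Let to := prod_action to1 to2.

Lemma prod_action_trans : [transitive setX G H, on [set: T * U] | to].
Proof.
have [/imsetP[x _ defT] /imsetP[y _ defU]] := (transG, transH).
apply/imsetP; exists (x, y) => //; apply/setP=> [[u v]]; rewrite inE; apply/esym.
have /orbitP[g gG <-] : u \in orbit to1 G x by rewrite -defT inE.
have /orbitP[h hH <-] : v \in orbit to2 H y by rewrite -defU inE.
by apply/orbitP; exists (g, h); rewrite ?inE ?gG.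
Qed.

Lemma orbit_setX (K1 : {group aT}) (K2 : {group bT}) z :
  orbit to (setX K1 K2) z = setX (orbit to1 K1 z.1) (orbit to2 K2 z.2).
Proof.
apply/setP=> [[u v]]; rewrite inE /=; apply/orbitP/andP.
  by case=> [[g h] /setXP[gK hK] [<- <-]]; rewrite !mem_orbit.
case=> /orbitP[g gK <-] /orbitP[h hK <-].
by exists (g, h) => //; apply/setXP.
Qed.

Lemma index_point_stab (cT : finGroupType) (V : finType)
    (to3 : {action cT &-> V}) (M : {group cT}) v :
  [transitive M, on [set: V] | to3] -> #|M : 'C_M[v | to3]| = #|V|.
Proof. by move=> tr; rewrite -card_orbit (atransP tr) ?inE // cardsT. Qed.

Hypothesis coTU : coprime #|T| #|U|.
Variable P : {set {set T * U}}.
Hypothesis invP : invariant_partition to (setX_group G H) P.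

(** Elements of [G x H] which keep [(x, y)] in its block form the stabiliser of
    the block, a subgroup that contains the stabiliser of [(x, y)]; by
    [coprime_Goursat] it therefore contains [(g, 1)] and [(1, h)] as soon as it
    contains [(g, h)]. *)
Lemma mem_pblock_split g h x y : g \in G -> h \in H ->
  (to1 x g, to2 y h) \in pblock P (x, y) ->
  (to1 x g, y) \in pblock P (x, y) /\ (x, to2 y h) \in pblock P (x, y).
Proof.
move=> gG hH gh_blk; pose L := [group of 'N_(setX G H)(pblock P (x, y) | to)].
have [/and3P[/eqP covP _ _] _] := invP.
have memL a b : a \in G -> b \in H ->
    ((a, b) \in L) = ((to1 x a, to2 y b) \in pblock P (x, y)).
  move=> aG bH; have abGH : (a, b) \in setX G H by apply/setXP.
  by rewrite inE abGH (astabs_pblock _ invP).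
have sStabL : setX 'C_G[x | to1] 'C_H[y | to2] \subset L.
  apply/subsetP=> [[a b]] /setXP[/setIP[aG /astab1P xa] /setIP[bH /astab1P yb]].
  by rewrite memL // xa yb mem_pblock covP inE.
have [] := @coprime_Goursat _ _ _ G _ H L sStabL (subsetIl _ _) g h.
- by rewrite !index_point_stab.
- by rewrite memL.
by rewrite !memL // !act1.
Qed.

Lemma equivalence_pblock : equivalence_rel (fun z w => w \in pblock P z).
Proof.
have [/and3P[/eqP covP tiP _] _] := invP.
have zP z : z \in cover P by rewrite covP inE.
move=> x y z; split; first by rewrite mem_pblock.
by move=> yx; rewrite (same_pblock tiP yx).
Qed.

(** Blocks are rectangles: a block containing two opposite corners contains the
    other two by the splitting of its stabiliser; conversely, translating by
    [G x 1] closes the rectangle from three corners. *)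
Lemma mem_pblock_prod u v x y :
  ((u, v) \in pblock P (x, y)) =
  ((u, y) \in pblock P (x, y)) && ((x, v) \in pblock P (x, y)).
Proof.
have [g gG ->] : exists2 g, g \in G & u = to1 x g by apply: (atransP2 transG).
have [h hH ->] : exists2 h, h \in H & v = to2 y h by apply: (atransP2 transH).
apply/idP/andP=> [/mem_pblock_split[] // | [uy xv]].
have gGH : (g, 1) \in setX G H by apply/setXP.
have := mem_pblock_act invP (x, y) (x, to2 y h) gGH.
rewrite /to /= /prod_act /= !act1 => defuv.
by rewrite ((equivalence_pblock _ _ _).2 uy) defuv.
Qed.

(** The relation induced on a fibre does not depend on the fibre, because the
    other factor permutes the parallel fibres transitively. *)
Lemma mem_pblock_fibre1 y y' x u :
  ((u, y) \in pblock P (x, y)) = ((u, y') \in pblock P (x, y')).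
Proof.
have [h hH ->] : exists2 h, h \in H & y' = to2 y h by apply: (atransP2 transH).
have hGH : (1, h) \in setX G H by apply/setXP.
have := mem_pblock_act invP (x, y) (u, y) hGH.
by rewrite /to /= /prod_act /= !act1.
Qed.

Lemma mem_pblock_fibre2 x x' y v :
  ((x, v) \in pblock P (x, y)) = ((x', v) \in pblock P (x', y)).
Proof.
have [g gG ->] : exists2 g, g \in G & x' = to1 x g by apply: (atransP2 transG).
have gGH : (g, 1) \in setX G H by apply/setXP.
have := mem_pblock_act invP (x, y) (x, v) gGH.
by rewrite /to /= /prod_act /= !act1.
Qed.

End CoprimeProduct.

Theorem preprimitive_prod (aT bT : finGroupType) (T U : finType)
    (to1 : {action aT &-> T}) (to2 : {action bT &-> U})
    (G : {group aT}) (H : {group bT}) :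
  preprimitive to1 G -> preprimitive to2 H -> coprime #|T| #|U| ->
  preprimitive (prod_action to1 to2) (setX_group G H).
Proof.
move=> ppG ppH coTU; have [[trG _] [trH _]] := (ppG, ppH).
split=> [|P invP]; first exact: prod_action_trans.
have [/imsetP[x0 _ _] /imsetP[y0 _ _]] := (trG, trH).
have eqP := equivalence_pblock invP.
have [||K1 sK1 defK1] := preprimitive_rel
  (e := fun x u => (u, y0) \in pblock P (x, y0)) ppG.
- by move=> x u w; apply: eqP.
- move=> g x u gG; have gGH : (g, 1) \in setX G H by apply/setXP.
  rewrite -(mem_pblock_act invP _ _ gGH) /= /prod_act /= act1 //.
have [||K2 sK2 defK2] := preprimitive_rel
  (e := fun y v => (x0, v) \in pblock P (x0, y)) ppH.
- by move=> y v w; apply: eqP.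
- move=> h y v hH; have hGH : (1, h) \in setX G H by apply/setXP.
  rewrite -(mem_pblock_act invP _ _ hGH) /= /prod_act /= act1 //.
exists (setX_group K1 K2); first exact: setXS.
have [partP _] := invP; apply/(orbit_partition_eq _ _ partP) => [[x y]].
apply/setP=> [[u v]]; rewrite orbit_setX inE /= -defK1 -defK2.
rewrite (mem_pblock_prod trG trH coTU invP).
by rewrite (mem_pblock_fibre1 trH invP y y0) (mem_pblock_fibre2 trG invP x x0).
Qed.

Unset Implicit Arguments.

Theorem theorem2p8 (Gamma Delta : finType)
    (G : {group {perm Gamma}}) (H : {group {perm Delta}})
    (transG : [transitive G, on [set: Gamma] | 'P])
    (transH : [transitive H, on [set: Delta] | 'P])
    (ppG : preprimitive 'P G) (ppH : preprimitive 'P H)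
    (coGD : coprime #|Gamma| #|Delta|) :
  preprimitive (prod_action 'P 'P) (setX_group G H).
Proof. exact: preprimitive_prod. Qed.
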